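(* For any symplectic manifold $(M,\omega)$ of positive dimension one can find three functions $F,G,H\in C^\infty_c(M)$ satisfying $\{F,\{G,H\}\}\not\equiv 0$ such that for every $\varepsilon>0$ there exist functions $F',G',H'\in C^\infty_c(M)$ with $\|F'-F\|<\varepsilon$, $\|G'-G\|<\varepsilon$, $\|H'-H\|<\varepsilon$ and $$\{F',\{G',H'\}\}\equiv 0 .$$
   Context: $(M,\omega)$ is nonempty and may be open or closed. $C^\infty_c(M)$ is the space of smooth compactly supported real-valued functions on $M$, with the uniform norm $\|F\|=\max_{x\in M}|F(x)|$. The Poisson bracket is $\{F,G\}=dF(X_G)$, where $X_G$ is the Hamiltonian vector field of $G$ with respect to $\omega$. *)

(* Defs.v *)
From HB Require Import structures.
From mathcomp Require Import all_boot all_order all_algebra.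
From mathcomp Require Import all_classical all_reals all_analysis.

Set Implicit Arguments.
Unset Strict Implicit.
Unset Printing Implicit Defensive.

Import Order.TTheory GRing.Theory Num.Theory.
Import numFieldNormedType.Exports.

Local Open Scope classical_set_scope.
Local Open Scope ring_scope.

(* [U] is meant to be open: only the germ of [f] at each point of [U]
   matters. *)
Fixpoint Ck_on (R : realType) (V W : normedModType R) (k : nat)
    (U : set V) (f : V -> W) : Prop :=
  if k is k'.+1 then
    (forall x, U x -> differentiable f x) /\
    (forall v : V, Ck_on k' U ('D_v f))
  else forall x, U x -> {for x, continuous f}.

Definition smooth_on (R : realType) (V W : normedModType R)
    (U : set V) (f : V -> W) : Prop :=
  forall k, Ck_on k U f.

(* The total functions [chart_map] and [chart_inv] are only meaningful on
   [chart_dom] and [chart_codom] respectively. *)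
Record chart (R : realType) (m : nat) (M : topologicalType) := Chart {
  chart_dom : set M ;
  chart_map : M -> 'rV[R]_m ;
  chart_inv : 'rV[R]_m -> M ;
  chart_dom_open : open chart_dom ;
  chart_codom_open : open (chart_map @` chart_dom) ;
  chart_mapK : {in chart_dom, cancel chart_map chart_inv} ;
  chart_map_continuous : {within chart_dom, continuous chart_map} ;
  chart_inv_continuous :
    {within chart_map @` chart_dom, continuous chart_inv} }.

Definition chart_codom (R : realType) (m : nat) (M : topologicalType)
  (c : chart R m M) : set 'rV[R]_m := chart_map c @` chart_dom c.

(* The atlas need not be maximal: every notion below is unchanged if it is
   replaced by the maximal atlas containing it. *)
Record smooth_manifold (R : realType) (m : nat) (M : topologicalType) :=
  SmoothManifold {
    atlas : set (chart R m M) ;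
    manifold_hausdorff : hausdorff_space M ;
    manifold_second_countable : @second_countable M ;
    atlas_cover : forall x : M, exists c, atlas c /\ chart_dom c x ;
    atlas_compatible : forall c d, atlas c -> atlas d ->
      smooth_on (chart_map c @` (chart_dom c `&` chart_dom d))
                (chart_map d \o chart_inv c) }.

Section SmoothManifold.
Context (R : realType) (m : nat) (M : topologicalType).
Variable S : smooth_manifold R m M.

Definition chart_at (x : M) : chart R m M := sval (cid (atlas_cover S x)).

(* A tangent vector at [x] is represented by its components in the preferred
   chart [chart_at x]. *)
Definition tangent_space (N : smooth_manifold R m M) (x : M) :
  normedModType R := 'rV[R]_m.

(* The tangent vector at [chart_inv c y] whose components in the chart [c]
   are [u]. *)
Definition tangent_of_coord (c : chart R m M) (y u : 'rV[R]_m) :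
    tangent_space S (chart_inv c y) :=
  'd (chart_map (chart_at (chart_inv c y)) \o chart_inv c) y u.

Definition smooth_function (F : M -> R) : Prop :=
  forall c, atlas S c -> smooth_on (chart_codom c) (F \o chart_inv c).

Definition differential (F : M -> R) (x : M) (u : tangent_space S x) : R :=
  'd (F \o chart_inv (chart_at x)) (chart_map (chart_at x) x) u.

Definition smooth_compactly_supported (F : M -> R) : Prop :=
  smooth_function F /\ compact (closure [set x | F x != 0]).

Definition form2 := forall x : M, tangent_space S x -> tangent_space S x -> R.

(* The coefficient of the 2-form [w] in the chart [c], at the point of
   coordinates [y], on the constant coordinate vector fields [u] and [v]. *)
Definition form2_coef (w : form2) (c : chart R m M) (u v y : 'rV[R]_m) : R :=
  w (chart_inv c y) (tangent_of_coord c y u) (tangent_of_coord c y v).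

(* Constant vector fields in a chart commute, so the cyclic sum in
   [symplectic_closed] is dw(u, v, t). *)
Record symplectic_form := SymplecticForm {
  symplectic_of : form2 ;
  symplectic_linear : forall x a (u u' v : tangent_space S x),
    symplectic_of (a *: u + u') v = a * symplectic_of u v + symplectic_of u' v ;
  symplectic_alternating : forall x (u v : tangent_space S x),
    symplectic_of u v = - symplectic_of v u ;
  symplectic_nondegenerate : forall x (u : tangent_space S x),
    (forall v : tangent_space S x, symplectic_of u v = 0) -> u = 0 ;
  symplectic_smooth : forall c u v, atlas S c ->
    smooth_on (chart_codom c) (form2_coef symplectic_of c u v) ;
  symplectic_closed : forall c u v t y, atlas S c -> chart_codom c y ->
    'D_u (form2_coef symplectic_of c v t) y +
    'D_v (form2_coef symplectic_of c t u) y +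
    'D_t (form2_coef symplectic_of c u v) y = 0 }.

Variable w : symplectic_form.

(* Sign convention w(X_G, .) = - dG; the opposite one changes the sign of the
   bracket, hence not the double bracket {F, {G, H}}. *)
Definition is_hamiltonian_vector (G : M -> R) (x : M) (u : tangent_space S x) :
    Prop :=
  forall v : tangent_space S x, symplectic_of w u v = - differential G v.

(* Exists and is unique by nondegeneracy of the form. *)
Definition hamiltonian_vector_field (G : M -> R) (x : M) : tangent_space S x :=
  xget 0 [set u | is_hamiltonian_vector G u].

Definition poisson_bracket (F G : M -> R) : M -> R :=
  fun x => differential F (hamiltonian_vector_field G x).

End SmoothManifold.

(* On nonempty [M] and for continuous compactly supported [F] this supremum is
   a maximum. *)
Definition uniform_norm (R : realType) (M : Type) (F : M -> R) : R :=
  sup (range (fun x => `|F x|)).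

(* Main.v *)
From HB Require Import structures.
Require Import Defs.
From mathcomp Require Import all_boot all_order all_algebra.
From mathcomp Require Import all_classical all_reals all_analysis.
From mathcomp Require Import ring lra.
Import Order.TTheory GRing.Theory Num.Theory.
Import numFieldNormedType.Exports.
Local Open Scope classical_set_scope.
Local Open Scope ring_scope.

Set Implicit Arguments.
Unset Strict Implicit.
Unset Printing Implicit Defensive.

(** Let [u] and [a] be functions on [M] and [s], [t] functions of one variable.
  By the chain rule, and because functions of [u] Poisson-commute,
  [[
    {s(u), {a, t(u)}} = s'(u) * t'(u) * {u, {a, u}},
  ]]
  so the double bracket vanishes identically as soon as [s' * t' = 0], whatever
  the value of [{u, {a, u}}].  The condition [s' * t' = 0] does not prevent
  [s] and [t] from being uniformly close to the identity: both can be smooth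
  staircases with small steps, each of which rises only where the other one is
  flat ([alternating_staircases]).  Hence [F = H = u] and [G = a] can be
  perturbed to [F' = s(u)], [H' = t(u)] and [G' = a], and what remains is to
  find [u] and [a] with [{u, {a, u}}] not identically zero.

  Everything happens inside one chart, in coordinates [y] around the point [y0].  The
  slope [u] is an affine function of one coordinate [y_j] and [a] is
  [(y_i - y0_i)^2].  Since [a] vanishes to second order at [y0],
  [{u, {a, u}} = - 2 {y_i, u}^2] there ([double_bracket]), and [{y_i, y_j}] is,
  up to sign, the [(i, j)] entry of the inverse of the matrix of the symplectic
  form.  As this inverse is not the zero matrix, some pair [(i, j)] gives a
  nonzero value.

  Compact supports are obtained by cutting off: [a] is multiplied by a plateau
  function, and [u], [s(u)] and [t(u)] by a wider one, equal to [1] around the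
  support of the first.  On the support of [a] the wider plateau is invisible,
  and near each point [F'] or [H'] is constant, so that the double bracket
  vanishes without any differentiation being carried out.  Off that support
  [{a, t(u)}] is zero near the point considered
  ([double_bracket_alternating_cut]).

  The smooth staircases and plateaus are built from [exp (- 1 / x)], and
  smoothness of functions on [M] is deduced from the closure properties of
  [Ck_on] under sums, products, quotients and compositions. *)

(** * Calculus of C^k functions *)

Section Calculus.
Context {R : realType}.
Implicit Types V W : normedModType R.

(** Differentiability in epsilon form, with an explicit candidate for the
  differential. *)
Lemma is_diff_linear V W (f : V -> W)
    (df : {linear V -> W}) (x : V) : continuous df ->
  (forall e, 0 < e ->
    \forall h \near 0, `|f (h + x) - f x - df h| <= e * `|h|) ->
  is_diff x f df.
Proof.
move=> cdf fdf; have fE : f \o shift x = cst (f x) + df +o_ 0 id.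
  apply/eqaddoP => e e0; apply: filterS (fdf e e0) => h.
  by rewrite !fctE /= opprD addrA.
have dE : 'd f x = df :> (V -> W) by exact: diff_unique.
apply: DiffDef; last exact: dE.
by apply/diff_locallyP; rewrite dE; exact: conj cdf fE.
Qed.

Lemma continuous_near0 V W (f : V -> W)
    (x : V) : {for x, continuous f} ->
  forall e, 0 < e -> \forall h \near 0, `|f x - f (h + x)| < e.
Proof.
move=> cf e e0; have H : \forall y \near x, `|f x - f y| < e.
  exact: (@cvgr_dist_lt _ _ _ _ _ _ _ cf _ e0).
by move: H; rewrite (near_shift 0) subr0.
Qed.

Lemma near_eq_is_diff V W (f g : V -> W) (x : V) :
  {near x, f =1 g} -> differentiable f x -> is_diff x g ('d f x).
Proof.
move=> fg df; have [dfc fE] := (diff_locallyP x f).1 df.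
apply: is_diff_linear => // e e0; move/eqaddoP: fE => /(_ e e0).
have fg0 : \forall h \near 0, f (h + x) = g (h + x).
  by move: fg; rewrite (near_shift 0) subr0; exact.
apply: filterS2 fg0 => h fgh; rewrite !fctE /= -fgh.
by rewrite (nbhs_singleton fg) opprD addrA.
Qed.

Lemma Ck_onW V W k U (f : V -> W) : Ck_on k.+1 U f -> Ck_on k U f.
Proof.
elim: k f => [|k IH] f /= [df H].
  by move=> x Ux; apply: differentiable_continuous; apply: df.
by split => // v; apply: IH; apply: H.
Qed.

(** Every clause of [Ck_on] is a condition on germs, because the germ of [f]
  determines the germs of its directional derivatives.  Smoothness on [U] can
  therefore be checked with a different model function around each point. *)
Lemma Ck_on_local V W k (U : set V) (f : V -> W) :
  (forall x, U x -> exists U' g,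
    [/\ U' x, {near x, g =1 f} & Ck_on k U' g]) ->
  Ck_on k U f.
Proof.
elim: k U f => [|k IH] U f fg /=.
  move=> x Ux; have [U' [g [U'x gf cg]]] := fg x Ux.
  rewrite /prop_for /continuous_at -(nbhs_singleton gf).
  by apply: cvg_trans (cg x U'x); apply: near_eq_cvg.
split => [x Ux|v].
  have [U' [g [U'x gf [dg _]]]] := fg x Ux.
  by have [] := near_eq_is_diff gf (dg x U'x).
apply: IH => x Ux; have [U' [g [U'x gf [dg Hg]]]] := fg x Ux.
exists U', ('D_v g); split => //; last exact: Hg.
move/nbhs_interior : gf; apply: filterS => y gfy.
exact: near_eq_derive.
Qed.

Lemma Ck_on_subset V W k (U U' : set V) (f : V -> W) :
  U' `<=` U -> Ck_on k U f -> Ck_on k U' f.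
Proof.
move=> sU kf; apply: Ck_on_local => x U'x; exists U, f; split => //.
  exact: sU.
exact: nearW.
Qed.

Lemma Ck_on_eq V W k (U : set V) (f g : V -> W) :
  open U -> {in U, f =1 g} -> Ck_on k U f -> Ck_on k U g.
Proof.
move=> oU fg kf; apply: Ck_on_local => x Ux; exists U, f; split => //.
apply: filterS (open_nbhs_nbhs (conj oU Ux)) => y Uy.
by apply: fg; rewrite inE.
Qed.

Lemma Ck_on_cst V W k (U : set V) (a : W) : Ck_on k U (fun=> a).
Proof.
elim: k a => [|k IH] a /=; first by move=> x _; exact: cvg_cst.
split => [x _|v]; first exact: differentiable_cst.
rewrite (_ : 'D_v _ = fun=> 0) //.
by apply/funext => x; exact: derive_cst.
Qed.

Lemma Ck_onD V W k (U : set V) (f g : V -> W) : open U ->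
  Ck_on k U f -> Ck_on k U g -> Ck_on k U (fun x => f x + g x).
Proof.
move=> oU; elim: k f g => [|k IH] f g /=.
  by move=> cf cg x Ux; apply: cvgD; [exact: cf|exact: cg].
move=> [df Hf] [dg Hg]; split => [x Ux|v].
  by apply: differentiableD; [exact: df|exact: dg].
apply: Ck_on_eq (IH _ _ (Hf v) (Hg v)) => // x /set_mem Ux.
by rewrite [RHS]deriveD //; apply: diff_derivable; [exact: df|exact: dg].
Qed.

Lemma Ck_onM V k (U : set V) (f g : V -> R) : open U ->
  Ck_on k U f -> Ck_on k U g -> Ck_on k U (fun x => f x * g x).
Proof.
move=> oU; elim: k f g => [|k IH] f g kf kg.
  by move=> x Ux; apply: cvgM; [exact: kf|exact: kg].
have [[df Hf] [dg Hg]] := (kf, kg); split => [x Ux|v].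
  by apply: differentiableM; [exact: df|exact: dg].
apply: Ck_on_eq (Ck_onD oU (IH _ _ (Ck_onW kf) (Hg v))
  (IH _ _ (Ck_onW kg) (Hf v))) => // x /set_mem Ux.
by rewrite [RHS]deriveM //; apply: diff_derivable; [exact: df|exact: dg].
Qed.

Lemma Ck_on_sum V W k (U : set V) (I : Type) (s : seq I) (f : I -> V -> W) :
  open U -> (forall i, Ck_on k U (f i)) ->
  Ck_on k U (fun x => \sum_(i <- s) f i x).
Proof.
move=> oU kf; elim: s => [|i s IH].
  rewrite (_ : (fun _ => _) = fun=> 0); first exact: Ck_on_cst.
  by apply/funext => x; rewrite big_nil.
rewrite (_ : (fun _ => _) = fun x => f i x + \sum_(i <- s) f i x).
  exact: Ck_onD.
by apply/funext => x; rewrite big_cons.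
Qed.

Lemma Ck_on_prod V k (U : set V) (I : Type) (s : seq I) (f : I -> V -> R) :
  open U -> (forall i, Ck_on k U (f i)) ->
  Ck_on k U (fun x => \prod_(i <- s) f i x).
Proof.
move=> oU kf; elim: s => [|i s IH].
  rewrite (_ : (fun _ => _) = fun=> 1); first exact: Ck_on_cst.
  by apply/funext => x; rewrite big_nil.
rewrite (_ : (fun _ => _) = fun x => f i x * \prod_(i <- s) f i x).
  exact: Ck_onM.
by apply/funext => x; rewrite big_cons.
Qed.

Lemma derive_comp (U V W : normedModType R) (f : V -> W) (g : U -> V) x v :
  differentiable g x -> differentiable f (g x) ->
  'D_v (f \o g) x = 'd f (g x) ('D_v g x).
Proof.
move=> dg df; have dfg := differentiable_comp dg df.
by rewrite (deriveE _ dfg) (deriveE _ dg) (diff_comp dg df).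
Qed.

Lemma derive_coord V m (g : V -> 'rV[R]_m) x v i : differentiable g x ->
  'D_v (fun y => g y 0 i) x = 'D_v g x 0 i.
Proof.
move=> dg.
pose p (u : 'rV[R]_m) : R := u 0 i.
have pl : linear p by move=> a u u'; rewrite /p !mxE.
pose P : {linear 'rV[R]_m -> R} :=
  HB.pack p (GRing.isLinear.Build _ _ _ _ _ pl).
rewrite (@derive_comp _ _ _ p) //; last exact: differentiable_coord.
by rewrite (diff_lin (f := P)) //; exact: coord_continuous.
Qed.

Lemma Ck_on_coord V m k (U : set V) (g : V -> 'rV[R]_m) i : open U ->
  Ck_on k U g -> Ck_on k U (fun x => g x 0 i).
Proof.
move=> oU; elim: k g => [|k IH] g /=.
  move=> cg x Ux.
  apply: (@continuous_comp _ _ _ g (fun u : 'rV[R]_m => u 0 i) x).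
    exact: cg.
  exact: coord_continuous.
move=> [dg Hg]; split => [x Ux|v].
  apply: (@differentiable_comp _ _ _ _ g (fun u : 'rV[R]_m => u 0 i)).
    exact: dg.
  exact: differentiable_coord.
apply: Ck_on_eq (IH _ (Hg v)) => // x /set_mem Ux.
by rewrite derive_coord //; exact: dg.
Qed.

(** Induction on [k]: [D_v (f o g)] is the sum of the products of the
  coordinates of [D_v g] with the partial derivatives of [f] composed with [g],
  all of which are one order less regular. *)
Lemma Ck_on_comp V m k (U : set V) (U' : set 'rV[R]_m) (f : 'rV[R]_m -> R)
    (g : V -> 'rV[R]_m) : open U ->
  (forall x, U x -> U' (g x)) -> Ck_on k U' f -> Ck_on k U g ->
  Ck_on k U (f \o g).
Proof.
move=> oU UU'; elim: k f g UU' => [|k IH] f g UU' kf kg.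
  by move=> x Ux; apply: continuous_comp; [exact: kg|exact/kf/UU'].
have [[df Hf] [dg Hg]] := (kf, kg); split => [x Ux|v].
  by apply: differentiable_comp; [exact: dg|exact/df/UU'].
pose h i x := 'D_v g x 0 i * 'D_(delta_mx 0 i) f (g x).
apply: (@Ck_on_eq _ _ _ _ (fun x => \sum_(i <- enum 'I_m) h i x)) => //.
  move=> x /set_mem Ux; have dgx := dg x Ux; have dfx := df _ (UU' _ Ux).
  rewrite derive_comp // [X in 'd f _ X]row_sum_delta linear_sum /= big_enum.
  apply: eq_bigr => i _.
  by rewrite /h (deriveE _ dfx) linearZ.
apply: Ck_on_sum => // i; apply: Ck_onM => //.
  exact: (@Ck_on_coord _ _ _ _ ('D_v g) i oU (Hg v)).
exact: (IH _ g UU' (Hf _) (Ck_onW kg)).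
Qed.

Lemma Ck_on_comp1 V k (U : set V) (U' : set R) (f : R -> R) (g : V -> R) :
  open U -> (forall x, U x -> U' (g x)) -> Ck_on k U' f -> Ck_on k U g ->
  Ck_on k U (f \o g).
Proof.
move=> oU UU'; elim: k f g UU' => [|k IH] f g UU' kf kg.
  by move=> x Ux; apply: continuous_comp; [exact: kg|exact/kf/UU'].
have [[df Hf] [dg Hg]] := (kf, kg); split => [x Ux|v].
  by apply: differentiable_comp; [exact: dg|exact/df/UU'].
apply: (@Ck_on_eq _ _ _ _ (fun x => 'D_v g x * 'D_1 f (g x))) => //.
  move=> x /set_mem Ux; have dgx := dg x Ux; have dfx := df _ (UU' _ Ux).
  rewrite [RHS]derive_comp // (deriveE _ dfx).
  have dZ a : 'd f (g x) (a *: 1) = a *: 'd f (g x) 1 by exact: linearZ.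
  by rewrite -[in RHS](mulr1 ('D_v g x)) [RHS]dZ.
apply: (Ck_onM oU (Hg v)).
exact: (IH ('D_1 f) g UU' (Hf 1) (Ck_onW kg)).
Qed.

Lemma Ck_on_id V k (U : set V) : Ck_on k U (@id V).
Proof.
case: k => [|k] /=; first by move=> x _; exact: cvg_id.
split => [x _|v]; first by have [] := is_diff_id x.
rewrite (_ : 'D_v id = fun=> v); first exact: Ck_on_cst.
by apply/funext => x; exact: derive_id.
Qed.

Lemma Ck_onV V k (U : set V) (f : V -> R) : open U ->
  (forall x, U x -> f x != 0) -> Ck_on k U f ->
  Ck_on k U (fun x => (f x)^-1).
Proof.
move=> oU f0; elim: k => [|k IH] kf.
  by move=> x Ux; apply: cvgV; [exact: f0|exact: kf].
have [df Hf] := kf; split => [x Ux|v].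
  by apply: differentiableV; [exact: df|exact: f0].
have kV := IH (Ck_onW kf).
apply: Ck_on_eq (Ck_onM oU (Ck_onM oU
  (Ck_onM oU (Ck_on_cst _ _ (- 1 : R)) kV) kV) (Hf v)) => //.
move=> x /set_mem Ux; rewrite [RHS]deriveV /=; last 2 first.
- exact: f0.
- exact/diff_derivable/df.
by rewrite expr2 invfM mulN1r mulNr.
Qed.

Section Factor.
Variables (U V W : normedModType R) (f : V -> W) (g : U -> V) (h : U -> W).
Variables (x : U) (z : V).
Hypotheses (gxz : g x = z) (dg : differentiable g x) (df : differentiable f z).
Hypothesis fgh : {near x, f \o g =1 h}.

Let dfg : differentiable (f \o g) x.
Proof. by apply: differentiable_comp dg _; rewrite gxz. Qed.

Lemma differentiable_factor : differentiable h x.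
Proof. by have [] := near_eq_is_diff fgh dfg. Qed.

Lemma diff_factor u : 'd h x u = 'd f z ('d g x u).
Proof.
have [_ ->] := near_eq_is_diff fgh dfg.
move: df; rewrite -gxz => df'.
by rewrite (diff_comp dg df').
Qed.

End Factor.

End Calculus.

(** * Smooth staircases *)

Section Staircase.
Context {R : realType}.
Implicit Types (x y z : R) (f g : R -> R).

(** In one variable all directional derivatives are multiples of the
  derivative, so a formula for the derivative suffices. *)
Lemma Ck_on_derive f f' k : (forall x, is_derive x 1 f (f' x)) ->
  Ck_on k setT f' -> Ck_on k.+1 setT f.
Proof.
move=> ff' kf'.
have df x : differentiable f x by apply/derivable1_diffP; case: (ff' x).
split => // v; rewrite (_ : 'D_v f = fun x => v * f' x); last first.
  apply/funext => x; have dZ a : 'd f x (a *: 1) = a *: 'd f x 1.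
    exact: linearZ.
  rewrite (deriveE _ (df x)) -[in LHS](mulr1 v) [LHS]dZ -(deriveE _ (df x)).
  by case: (ff' x) => _ ->.
exact: (Ck_onM openT (Ck_on_cst _ _ v)).
Qed.

(** The family [x^-n exp(-1/x)], extended by [0] on the left, contains the
  classical flat function ([n = 0]) and is stable under differentiation up to
  linear combinations; proving continuity of all members at once gives
  smoothness. *)
Definition flat n x := if 0 < x then x^-1 ^+ n * expR (- x^-1) else 0.

(** The exponential [exp (1/x)] dominates the term of degree [n + 1] of its
  series, which leaves one factor [x] to spare. *)
Lemma flat_le n x : `|flat n x| <= n.+1`!%:R * `|x|.
Proof.
rewrite /flat; case: ifPn => [x0|_]; last by rewrite normr0 mulr_ge0.
have y0 : 0 < x^-1 by rewrite invr_gt0.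
rewrite !gtr0_norm ?mulr_gt0 ?exprn_gt0 ?expR_gt0 //.
have := expR_ge1Dxn n (ltW y0).
have : 0 < n.+1`!%:R :> R by rewrite ltr0n fact_gt0.
move: (n.+1`!%:R : R) => c c0 yE.
rewrite expRN ler_pdivrMr ?expR_gt0 //.
have -> : x^-1 ^+ n = c * x * (x^-1 ^+ n.+1 / c).
  by rewrite exprS; field; rewrite !gt_eqF.
rewrite ler_pM2l ?mulr_gt0 //.
by apply: le_trans yE; rewrite lerDr.
Qed.

Lemma flat_cvg0 n : flat n @ 0 --> (0 : R).
Proof.
apply/cvgrPdist_lt => e e0; near=> x; rewrite sub0r normrN.
apply: le_lt_trans (flat_le n x) _; rewrite -ltr_pdivlMl ?ltr0n ?fact_gt0 //.
near: x; exists ((n.+1`!%:R)^-1 * e) => /=.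
  by rewrite mulr_gt0 // invr_gt0 ltr0n fact_gt0.
by move=> x; rewrite /= sub0r normrN.
Unshelve. all: by end_near. Qed.

Lemma is_derive_flat n x :
  is_derive x 1 (flat n) (flat n.+2 x - n%:R * flat n.+1 x).
Proof.
have [x0|x0|->] := ltgtP x 0.
- have -> : flat n.+2 x - n%:R * flat n.+1 x = 0.
    by rewrite /flat ltNge (ltW x0) mulr0 subrr.
  apply: (@near_eq_is_derive _ _ _ (cst 0 : R -> R)).
  near=> y; rewrite /flat /= ltNge (_ : y <= 0) //.
  by near: y; exact: lt_le_nbhsl.
- have dV : is_derive x 1 (fun y => y^-1) (- x ^- 2).
    rewrite -[- x ^- 2]mulr1.
    exact: (is_deriveV (f := id) (lt0r_neq0 x0) (is_derive_id x 1)).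
  have dE : is_derive x 1 (expR \o (fun y => - y^-1))
    (expR (- x^-1) * - (- x ^- 2)).
    exact: (is_derive1_comp (is_derive_expR _) (is_deriveN dV)).
  have dF := is_deriveM (is_deriveX n dV) dE.
  apply: (@near_eq_is_derive _ _ _ 
    ((fun y => y^-1) ^+ n * (expR \o (fun y => - y^-1)))).
    near=> y; rewrite /flat (_ : 0 < y) ?fctE //.
    by near: y; exact: lt_nbhsr.
  move: dF; rewrite !fctE /=; congr is_derive.
  rewrite /flat x0 -exprVn /GRing.scale /=; move: (x^-1) (expR _) => y E.
  case: n => [|n] /=; first by rewrite expr0 !mul0r mulr0; ring.
  by rewrite !exprS; ring.
(* At the origin the difference quotient of one member of the family is the
   next member. *)
- have fE : (fun h : R => h^-1 *: ((flat n \o shift 0) (h *: 1) - flat n 0)) =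
            flat n.+1.
    apply/funext => h; rewrite /flat /= ltxx subr0 addr0 [h *: 1]mulr1.
    by case: ifPn => h0; rewrite /GRing.scale /= ?mulr0 // exprS mulrA.
  have fc : flat n.+1 @ 0^' --> (0 : R).
    by apply: cvg_trans (flat_cvg0 n.+1); apply: cvg_app; exact: cvg_within.
  rewrite {2 3}/flat ltxx mulr0 subrr; apply: DeriveDef.
    by rewrite /derivable fE; apply/cvg_ex; exists 0.
  by rewrite /derive fE; apply/cvg_lim.
Unshelve. all: by end_near. Qed.

Lemma Ck_on_flat k n : Ck_on k setT (flat n).
Proof.
elim: k n => [|k IH] n.
  move=> x _; apply/differentiable_continuous/derivable1_diffP.
  by case: (is_derive_flat n x).
apply: (Ck_on_derive (is_derive_flat n)).
apply: (Ck_onD openT (IH n.+2)).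
rewrite (_ : (fun _ => _) = fun x => - n%:R * flat n.+1 x); last first.
  by apply/funext => x; rewrite mulNr.
exact: (Ck_onM openT (Ck_on_cst _ _ _)).
Qed.

Definition smooth_step x := flat 0 x / (flat 0 x + flat 0 (1 - x)).

Lemma flat_ge0 x : 0 <= flat 0 x.
Proof. by rewrite /flat; case: ifP => // _; rewrite mul1r expR_ge0. Qed.

Lemma flat_gt0 x : 0 < x -> 0 < flat 0 x.
Proof. by move=> x0; rewrite /flat x0 mul1r expR_gt0. Qed.

Lemma flat_eq0 x : x <= 0 -> flat 0 x = 0.
Proof. by rewrite /flat ltNge => ->. Qed.

Lemma smooth_step_denom_gt0 x : 0 < flat 0 x + flat 0 (1 - x).
Proof.
have [x0|x0] := ltP 0 x; first by rewrite ltr_wpDr ?flat_ge0 ?flat_gt0.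
by rewrite ltr_wpDl ?flat_ge0 ?flat_gt0 // subr_gt0 (le_lt_trans x0).
Qed.

Lemma smooth_step0 x : x <= 0 -> smooth_step x = 0.
Proof. by move=> x0; rewrite /smooth_step flat_eq0 // mul0r. Qed.

Lemma smooth_step1 x : 1 <= x -> smooth_step x = 1.
Proof.
move=> x1; rewrite /smooth_step (@flat_eq0 (1 - x)) ?subr_le0 // addr0 divff //.
by rewrite gt_eqF // flat_gt0 // (lt_le_trans _ x1).
Qed.

Lemma smooth_step_ge0 x : 0 <= smooth_step x.
Proof. by rewrite divr_ge0 ?flat_ge0 // ltW // smooth_step_denom_gt0. Qed.

Lemma smooth_step_le1 x : smooth_step x <= 1.
Proof.
by rewrite ler_pdivrMr ?smooth_step_denom_gt0 // mul1r lerDl flat_ge0.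
Qed.

Lemma Ck_on_affine k (a b : R) : Ck_on k setT (fun x => a * x + b).
Proof.
apply: (Ck_onD openT _ (Ck_on_cst _ _ b)).
exact: (Ck_onM openT (Ck_on_cst _ _ a) (Ck_on_id _ _)).
Qed.

Lemma Ck_on_smooth_step k : Ck_on k setT smooth_step.
Proof.
apply: (Ck_onM openT (Ck_on_flat k 0)); apply: (Ck_onV openT) => [x _|].
  by rewrite gt_eqF // smooth_step_denom_gt0.
apply: (Ck_onD openT (Ck_on_flat k 0)).
rewrite (_ : (fun _ => _) = flat 0 \o (fun x => -1 * x + 1)); last first.
  by apply/funext => x /=; rewrite mulN1r addrC.
exact: (Ck_on_comp1 openT (U' := setT) _ (Ck_on_flat k 0) (Ck_on_affine _ _ _)).
Qed.

(** The step number [k] rises for [z] between [k + b/4] and [k + (b+1)/4].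
  The offsets [b = 0] and [b = 2] give rises whose closures are disjoint. *)
Definition staircase (b : R) (n : nat) z :=
  \sum_(k <- iota 0 n) smooth_step (4 * (z - k%:R) - b).

Lemma Ck_on_staircase (b : R) n k : Ck_on k setT (staircase b n).
Proof.
apply: (Ck_on_sum _ openT) => j.
rewrite (_ : (fun _ => _) = smooth_step \o
  (fun x => 4 * x + - (4 * j%:R + b))); last first.
  by apply/funext => x /=; congr smooth_step; ring.
exact: (Ck_on_comp1 openT (U' := setT) _ (Ck_on_smooth_step k)
  (Ck_on_affine _ _ _)).
Qed.

Lemma staircase_dist (b : R) n z : 0 <= b <= 3 -> 0 <= z <= n%:R ->
  `|staircase b n z - z| <= 1.
Proof.
move=> /andP[b0 b3] /andP[z0 zn].
suff [_ /(_ zn)] : (n%:R <= z -> staircase b n z = n%:R) /\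
  (z <= n%:R -> `|staircase b n z - z| <= 1) by [].
elim: n {zn} => [|n [IHge IHle]].
  rewrite /staircase big_nil; split => // z0'.
  by rewrite (_ : z = 0) ?subrr ?normr0 //; apply/le_anti/andP.
have E : staircase b n.+1 z =
    staircase b n z + smooth_step (4 * (z - n%:R) - b).
  by rewrite /staircase -addn1 iotaD big_cat /= big_seq1.
have nS : n.+1%:R = n%:R + 1 :> R by rewrite -addn1 natrD.
rewrite E nS; split => zn.
  by rewrite IHge ?smooth_step1 //; lra.
have [nz|nz] := leP n%:R z.
  rewrite IHge //; have := smooth_step_ge0 (4 * (z - n%:R) - b).
  have := smooth_step_le1 (4 * (z - n%:R) - b).
  move: (smooth_step _) => s s1 s0; rewrite ler_norml; lra.
by rewrite smooth_step0 ?addr0; [exact/IHle/ltW|lra].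
Qed.

Lemma smooth_step_locally_cst x : x < 0 \/ 1 < x ->
  \forall y \near x, smooth_step y = smooth_step x.
Proof.
case=> x0; near=> y.
  rewrite !smooth_step0 //; first exact: ltW.
  by near: y; exact: lt_le_nbhsl.
rewrite !smooth_step1 //; first exact: ltW.
by near: y; exact: lt_le_nbhsr.
Unshelve. all: by end_near. Qed.

Lemma staircase_locally_cst (b : R) n z :
  (forall j : nat, 4 * (z - j%:R) - b < 0 \/ 1 < 4 * (z - j%:R) - b) ->
  \forall y \near z, staircase b n y = staircase b n z.
Proof.
move=> H.
have nj (j : 'I_n) : \forall y \near z,
    smooth_step (4 * (y - j%:R) - b) = smooth_step (4 * (z - j%:R) - b).
  have c : (fun y => 4 * (y - j%:R) - b) @ z --> 4 * (z - j%:R) - b.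
    apply: cvgB; last exact: cvg_cst.
    apply: cvgM; first exact: cvg_cst.
    by apply: cvgB; [exact: cvg_id|exact: cvg_cst].
  exact: (c _ (smooth_step_locally_cst (H j))).
apply: filterS (filter_forall _ nj) => y yz.
rewrite /staircase -[n]subn0 -/(index_iota 0 n) !big_mkord.
by apply: eq_bigr => j _; exact: yz.
Qed.

(** On the closed interval where a step with offset [0] rises, the rises with
  offset [2] are at a positive distance; elsewhere the first staircase is
  locally constant. *)
Lemma staircases_alternate n z :
  (\forall y \near z, staircase 0 n y = staircase 0 n z) \/
  (\forall y \near z, staircase 2 n y = staircase 2 n z).
Proof.
have [[j /andP[j0 j1]]|noj] :=
  pselect (exists j : nat, 0 <= 4 * (z - j%:R) <= 1); last first.
  left; apply: staircase_locally_cst => j; rewrite subr0.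
  have [?|z0] := ltP (4 * (z - j%:R)) 0; first by left.
  have [?|z1] := ltP 1 (4 * (z - j%:R)); first by right.
  by case: noj; exists j; rewrite z0.
right; apply: staircase_locally_cst => i.
have [ij|ji|->] := ltngtP i j.
- right; have : i%:R + 1 <= j%:R :> R by rewrite -(natrD _ i 1) addn1 ler_nat.
  lra.
- left; have : j%:R + 1 <= i%:R :> R by rewrite -(natrD _ j 1) addn1 ler_nat.
  lra.
- left; lra.
Qed.

(** Rescaling the two staircases so that their steps have height [e].  They
  have finitely many steps, hence the restriction to a bounded interval. *)
Lemma alternating_staircases (L e : R) : 0 <= L -> 0 < e ->
  exists s t : R -> R,
    [/\ forall k, Ck_on k setT s, forall k, Ck_on k setT t,
        forall x, 0 <= x <= L -> `|s x - x| <= e,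
        forall x, 0 <= x <= L -> `|t x - x| <= e
      & forall x, (\forall y \near x, s y = s x) \/
                  (\forall y \near x, t y = t x)].
Proof.
move=> L0 e0; pose n := Num.bound (L / e).
have Ln : L / e <= n%:R by rewrite ltW // archi_boundP // divr_ge0 // ltW.
pose s b x := e * staircase b n (e^-1 * x).
have sk b k : Ck_on k setT (s b).
  apply: (Ck_onM openT (Ck_on_cst _ _ e)).
  apply: (Ck_on_comp1 openT (U' := setT) _ (Ck_on_staircase b n k)) => //.
  exact: (Ck_onM openT (Ck_on_cst _ _ e^-1) (Ck_on_id _ _)).
have se b x : 0 <= b <= 3 -> 0 <= x <= L -> `|s b x - x| <= e.
  move=> b3 /andP[x0 xL].
  rewrite -{2}(mulVKf (lt0r_neq0 e0) x) -mulrBr normrM gtr0_norm //.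
  rewrite ger_pMr // staircase_dist // mulr_ge0 ?invr_ge0 ?(ltW e0) //=.
  by rewrite (le_trans _ Ln) // mulrC ler_pM2r ?invr_gt0.
exists (s 0), (s 2); split => //.
- by move=> x; apply: se; lra.
- by move=> x; apply: se; lra.
move=> x; have c : (fun y => e^-1 * y) @ x --> e^-1 * x.
  by apply: cvgM; [exact: cvg_cst|exact: cvg_id].
by case: (staircases_alternate n (e^-1 * x)) => H; [left|right];
  move: (c _ H); rewrite /= nbhs_simpl /=; apply: filterS => y /= yx;
  rewrite /s yx.
Qed.

End Staircase.

(** * Plateaus, gradients and inverse matrices *)

Section RowVectors.
Context {R : realType} {m : nat}.
Implicit Types (x y : 'rV[R]_m) (r : R).

Lemma coord_le_norm x i : `|x 0 i| <= `|x|.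
Proof.
rewrite [leRHS]/Num.norm /= mx_normrE; apply/bigmax_geP; right => /=.
by exists (0, i).
Qed.

Lemma norm_attained x : 0 < `|x| -> exists i, `|x| = `|x 0 i|.
Proof.
move=> x0; have [[a i] E] := mx_norm_neq0 (lt0r_neq0 x0).
by exists i; rewrite [LHS]E /= ord1.
Qed.

Lemma compact_box x r : compact [set y | `|y - x| <= r].
Proof.
have -> : [set y | `|y - x| <= r] = closed_ball_ Num.norm x r.
  by apply/seteqP; split => y /=; rewrite distrC.
apply: bounded_closed_compact; last exact: closed_closed_ball_.
rewrite /bounded_set; exists (r + `|x|); split; first exact: num_real.
move=> M Mr y /= yx; rewrite -(subrK x y) (le_trans (ler_normD _ _)) //.
by rewrite (le_trans _ (ltW Mr)) // lerD2r distrC.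
Qed.

(** Equal to [1] for [`|t| <= 3] and to [0] for [`|t| >= 4]. *)
Definition plateau1 (t : R) := smooth_step (4 - t) * smooth_step (4 + t).

Definition plateau x r y :=
  \prod_(i <- enum 'I_m) plateau1 (r^-1 * (y 0 i - x 0 i)).

Lemma Ck_on_scaled_coord x r (b : R) i k :
  Ck_on k setT (fun y => r^-1 * (y 0 i - x 0 i) + b).
Proof.
apply: (Ck_onD openT _ (Ck_on_cst _ _ _)).
apply: (Ck_onM openT (Ck_on_cst _ _ _)).
apply: (Ck_onD openT _ (Ck_on_cst _ _ _)).
exact: (Ck_on_coord _ openT (Ck_on_id _ _)).
Qed.

Lemma Ck_on_plateau x r k : Ck_on k setT (plateau x r).
Proof.
apply: (Ck_on_prod _ openT) => i.
have kp : Ck_on k setT plateau1.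
  rewrite (_ : plateau1 = fun t => smooth_step (-1 * t + 4) *
    smooth_step (1 * t + 4)); last first.
    by apply/funext => t; rewrite /plateau1 mulN1r mul1r ![_ + 4]addrC.
  by apply: (Ck_onM openT); apply: (Ck_on_comp1 openT (U' := setT) _
    (Ck_on_smooth_step k) (Ck_on_affine _ _ _)).
have := Ck_on_scaled_coord x r 0 i k.
under eq_fun do rewrite addr0.
exact: (Ck_on_comp1 openT (U' := setT) _ kp).
Qed.

Lemma plateau_ge0 x r y : 0 <= plateau x r y.
Proof. by apply: prodr_ge0 => i _; rewrite mulr_ge0 ?smooth_step_ge0. Qed.

Lemma plateau_le1 x r y : plateau x r y <= 1.
Proof.
apply: numdomain.Num.Theory.prodr_ile1 => i _.
by rewrite mulr_ge0 ?smooth_step_ge0 //= mulr_ile1 ?smooth_step_ge0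
  ?smooth_step_le1.
Qed.

Lemma plateau_eq1 x r y : 0 < r -> `|y - x| <= 3 * r -> plateau x r y = 1.
Proof.
move=> r0 yx; apply: big1_seq => i _.
have : `|r^-1 * (y 0 i - x 0 i)| <= 3.
  rewrite normrM gtr0_norm ?invr_gt0 // ler_pdivrMl // mulrC.
  by have := coord_le_norm (y - x) i; rewrite !mxE => /le_trans; exact.
rewrite /plateau1 ler_norml => /andP[t1 t2].
by rewrite !smooth_step1 ?mul1r //; lra.
Qed.

Lemma plateau_eq0 x r y : 0 < r -> 4 * r <= `|y - x| -> plateau x r y = 0.
Proof.
move=> r0 yx; have yx0 : 0 < `|y - x| by apply: lt_le_trans yx; lra.
have [i yxE] := norm_attained yx0.
apply/eqP; rewrite /plateau big_enum prodf_seq_eq0; apply/hasP.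
exists i; first by rewrite mem_index_enum.
have : 4 <= `|r^-1 * (y 0 i - x 0 i)|.
  rewrite normrM gtr0_norm ?invr_gt0 // ler_pdivlMl // mulrC.
  by move: yx; rewrite yxE !mxE.
rewrite /plateau1 /= ler_normr => /orP[] t4; rewrite mulf_eq0.
  by rewrite smooth_step0 ?eqxx //; lra.
by rewrite orbC smooth_step0 ?eqxx //; lra.
Qed.

(** Product rule at a zero of the first factor: the second factor only needs
  to be continuous. *)
Lemma is_diff_coord_mul x i (f : 'rV[R]_m -> R) : {for x, continuous f} ->
  is_diff x (fun y => (y 0 i - x 0 i) * f y) (fun u => f x * u 0 i).
Proof.
move=> cf.
pose p (u : 'rV[R]_m) : R := f x * u 0 i.
have pl : linear p.
  by move=> a u u'; rewrite /p !mxE mulrDr mulrCA.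
pose P : {linear 'rV[R]_m -> R} :=
  HB.pack p (GRing.isLinear.Build _ _ _ _ _ pl).
have Pc : continuous P.
  move=> u; apply: (@cvgM _ _ (nbhs (u : 'rV[R]_m)) _ (fun=> f x)
    (fun v : 'rV[R]_m => v 0 i)).
    exact: cvg_cst.
  exact: coord_continuous.
apply: (@is_diff_linear _ _ _ _ P) => // e e0.
have := continuous_near0 cf e0.
apply: filterS => h fh; rewrite subrr mul0r subr0.
rewrite mxE addrK mulrC /= /p -mulrBl normrM distrC.
by rewrite ler_pM // ?(ltW fh) // coord_le_norm.
Qed.

Lemma cvg_det {T : Type} (F : set_system T) n {FF : Filter F}
    (A : T -> 'M[R]_n) (B : 'M[R]_n) :
  (forall i j, A t i j @[t --> F] --> B i j) ->
  \det (A t) @[t --> F] --> \det B.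
Proof.
move=> AB; apply: cvg_big => [|s _]; first exact: add_continuous.
apply: cvgM; first exact: cvg_cst.
by apply: cvg_big => [|i _ //]; exact: mul_continuous.
Qed.

(** Cramer's rule: the entries of the inverse are rational functions of those
  of the matrix. *)
Lemma cvg_invmx {T : Type} (F : set_system T) n {FF : Filter F}
    (A : T -> 'M[R]_n) (B : 'M[R]_n) : (\forall t \near F, A t \in unitmx) ->
  B \in unitmx -> (forall i j, A t i j @[t --> F] --> B i j) ->
  forall i j, invmx (A t) i j @[t --> F] --> invmx B i j.
Proof.
move=> uA uB AB i j.
have detB : \det B != 0 by rewrite -unitfE -unitmxE.
have invE : \forall t \near F,
    (\det (A t))^-1 * cofactor (A t) j i = invmx (A t) i j.
  by apply: filterS uA => t uAt; rewrite /invmx uAt !mxE.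
apply: cvg_trans; first exact: near_eq_cvg invE.
rewrite /invmx uB !mxE; apply: cvgM; first exact: cvgV (cvg_det AB).
apply: cvgM; first exact: cvg_cst.
apply: cvg_det => a b; rewrite !mxE.
under eq_cvg do rewrite !mxE.
exact: AB.
Qed.

Definition gradient (f : 'rV[R]_m -> R) z : 'rV[R]_m :=
  \row_q 'd f z (delta_mx 0 q).

Lemma gradientE f z u : 'd f z u = (gradient f z *m u^T) 0 0.
Proof.
rewrite [in LHS](row_sum_delta u) linear_sum mxE.
by apply: eq_bigr => q _; rewrite linearZ !mxE /= mulrC.
Qed.

Lemma is_diff_coord (y : 'rV[R]_m) i :
  is_diff y (fun z : 'rV[R]_m => z 0 i : R) (fun v : 'rV[R]_m => v 0 i).
Proof.
apply: DiffDef; first exact: differentiable_coord.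
apply/funext => v; rewrite -deriveE; last exact: differentiable_coord.
by rewrite (derive_coord (g := id)) ?derive_id.
Qed.

Lemma gradient_affine (y : 'rV[R]_m) i (a b : R) (f : 'rV[R]_m -> R) :
  {near y, (fun z : 'rV[R]_m => a * z 0 i + b) =1 f} ->
  differentiable f y /\ gradient f y = a *: delta_mx 0 i.
Proof.
move=> fE.
have dC := is_diff_coord y i.
have dA : is_diff y (a *: (fun z : 'rV[R]_m => z 0 i : R) + cst b)
    (a *: (fun v : 'rV[R]_m => v 0 i : R) + 0).
  exact: is_diffD.
have [df dE] := near_eq_is_diff fE (@ex_diff _ _ _ _ _ _ _ dA).
split => //; apply/rowP => q; rewrite !mxE dE.
by rewrite (@diff_val _ _ _ _ _ _ _ dA) !fctE /= addr0 !mxE eq_sym.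
Qed.

Lemma gradient_square (y : 'rV[R]_m) i (a : R) (f : 'rV[R]_m -> R) :
  {near y, (fun z : 'rV[R]_m => (z 0 i - a) ^+ 2) =1 f} ->
  differentiable f y /\ gradient f y = (2 * (y 0 i - a)) *: delta_mx 0 i.
Proof.
move=> fE.
have dC := is_diff_coord y i.
have dB : is_diff y ((fun z : 'rV[R]_m => z 0 i : R) - cst a)
    ((fun v : 'rV[R]_m => v 0 i : R) - 0).
  exact: is_diffB.
have dA := is_diffM dB dB.
have [df dE] := near_eq_is_diff fE (@ex_diff _ _ _ _ _ _ _ dA).
split => //; apply/rowP => q; rewrite !mxE dE.
rewrite (@diff_val _ _ _ _ _ _ _ dA) !fctE /= subr0 !mxE eq_sym.
by rewrite /GRing.scale /=; ring.
Qed.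

Lemma gradient_coord_mul (y : 'rV[R]_m) i (k f : 'rV[R]_m -> R) :
  {for y, continuous k} ->
  {near y, (fun z : 'rV[R]_m => (z 0 i - y 0 i) * k z) =1 f} ->
  differentiable f y /\ gradient f y = k y *: delta_mx 0 i.
Proof.
move=> ck fE; have dA := is_diff_coord_mul i ck.
have [df dE] := near_eq_is_diff fE (@ex_diff _ _ _ _ _ _ _ dA).
split => //; apply/rowP => q; rewrite !mxE dE.
by rewrite (@diff_val _ _ _ _ _ _ _ dA) !mxE eq_sym.
Qed.

End RowVectors.

(** * Functions and differentials in charts *)

Section Charts.
Context {R : realType} {m : nat} {M : topologicalType}.
Implicit Types (c d : chart R m M) (x : M) (y : 'rV[R]_m).

Lemma chart_map_cvg c x : chart_dom c x ->
  {for x, continuous (chart_map c)}.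
Proof.
move=> cx; have := @chart_map_continuous _ _ _ c.
rewrite (continuous_open_subspace _ (@chart_dom_open _ _ _ c)); apply.
by rewrite inE.
Qed.

Lemma chart_inv_cvg c y : chart_codom c y ->
  {for y, continuous (chart_inv c)}.
Proof.
move=> cy; have := @chart_inv_continuous _ _ _ c.
rewrite (continuous_open_subspace _ (@chart_codom_open _ _ _ c)); apply.
by rewrite inE.
Qed.

Lemma chart_mapKV c x : chart_dom c x -> chart_inv c (chart_map c x) = x.
Proof. by move=> cx; rewrite chart_mapK // inE. Qed.

Lemma chart_map_codom c x : chart_dom c x -> chart_codom c (chart_map c x).
Proof. by move=> cx; exists x. Qed.

Lemma chart_inv_dom c y : chart_codom c y -> chart_dom c (chart_inv c y).
Proof. by move=> [x cx <-]; rewrite chart_mapKV. Qed.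

Lemma chart_invK c y : chart_codom c y -> chart_map c (chart_inv c y) = y.
Proof. by move=> [x cx <-]; rewrite chart_mapKV. Qed.

Lemma near_chart_codom c y : chart_codom c y ->
  \forall z \near y, chart_codom c z.
Proof.
by move=> cy; apply: open_nbhs_nbhs; split; [exact: chart_codom_open|].
Qed.

Lemma near_chart_dom c x : chart_dom c x -> \forall z \near x, chart_dom c z.
Proof.
by move=> cx; apply: open_nbhs_nbhs; split; [exact: chart_dom_open|].
Qed.

Lemma chart_overlap_open c d :
  open (chart_map c @` (chart_dom c `&` chart_dom d)).
Proof.
rewrite openE => y [x [cx dx] <-]; have cy := chart_map_codom cx.
have near_d : \forall z \near chart_map c x, chart_dom d (chart_inv c z).
  by apply: chart_inv_cvg => //; rewrite chart_mapKV //; exact: near_chart_dom.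
apply: filterS2 near_d (near_chart_codom cy) => z dz cz.
exists (chart_inv c z); last exact: chart_invK.
by split => //; exact: chart_inv_dom.
Qed.

Lemma chart_inv_compact c (K : set 'rV[R]_m) : compact K ->
  K `<=` chart_codom c -> compact (chart_inv c @` K).
Proof.
move=> cK Kc; apply: continuous_compact cK.
exact: continuous_subspaceW Kc (@chart_inv_continuous _ _ _ c).
Qed.

Definition chart_ext c (f : 'rV[R]_m -> R) x : R :=
  if x \in chart_dom c then f (chart_map c x) else 0.

Lemma chart_ext_in c f x : chart_dom c x ->
  chart_ext c f x = f (chart_map c x).
Proof. by move=> cx; rewrite /chart_ext (mem_set cx). Qed.

Lemma chart_ext_inv c f y : chart_codom c y ->
  chart_ext c f (chart_inv c y) = f y.
Proof.
by move=> cy; rewrite chart_ext_in ?chart_invK //; exact: chart_inv_dom.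
Qed.

Variable S : smooth_manifold R m M.

Lemma chart_ext_eq0 c f (K : set 'rV[R]_m) x :
  (forall y, chart_codom c y -> ~ K y -> f y = 0) -> compact K ->
  K `<=` chart_codom c -> ~ (chart_inv c @` K) x ->
  \forall z \near x, chart_ext c f z = 0.
Proof.
move=> f0 cK Kc Kx.
have cptK := chart_inv_compact cK Kc.
have := compact_closed (manifold_hausdorff S) cptK => clK.
have := open_nbhs_nbhs (conj (closed_openC clK) Kx).
apply: filterS => z Kz; rewrite /chart_ext; case: ifPn => // /set_mem cz.
apply: f0; first exact: chart_map_codom.
by move=> Kcz; apply: Kz; exists (chart_map c z); rewrite ?chart_mapKV.
Qed.

(** In another chart [d] the extension is either [f] composed with a transition
  map, or, at a point outside [chart_dom c], locally zero.  The second case uses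
  that [chart_inv c @` K] is closed, thus that [M] is Hausdorff. *)
Lemma smooth_chart_ext c f (K : set 'rV[R]_m) : atlas S c ->
  (forall k, Ck_on k (chart_codom c) f) ->
  (forall y, chart_codom c y -> ~ K y -> f y = 0) -> compact K ->
  K `<=` chart_codom c -> smooth_compactly_supported S (chart_ext c f).
Proof.
move=> Sc kf f0 cK Kc; split; last first.
  have cptK := chart_inv_compact cK Kc.
  apply: (subclosed_compact _ cptK); first exact: closed_closure.
  rewrite [X in _ `<=` X](closure_id _).1; last first.
    exact: compact_closed (manifold_hausdorff S) cptK.
  apply: closure_subset => x /= /eqP fx; apply: contrapT => Kx.
  by apply: fx; exact: nbhs_singleton (chart_ext_eq0 f0 cK Kc Kx).
move=> d Sd k; apply: Ck_on_local => y dy.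
have [cy|cy] := pselect (chart_dom c (chart_inv d y)).
  have ddy := chart_inv_dom dy.
  exists (chart_map d @` (chart_dom d `&` chart_dom c)),
    (f \o (chart_map c \o chart_inv d)); split.
  - by exists (chart_inv d y) => //; exact: chart_invK.
  - have near_c : \forall z \near y, chart_dom c (chart_inv d z).
      by apply: chart_inv_cvg => //; exact: near_chart_dom.
    by apply: filterS near_c => z cz; rewrite /= chart_ext_in.
  - apply: (@Ck_on_comp _ _ _ k _ (chart_codom c) f) (kf k) _.
    + exact: chart_overlap_open.
    + move=> _ [x [dx cx] <-] /=; rewrite chart_mapKV //.
      exact: chart_map_codom.
    + exact: (atlas_compatible Sd Sc).
exists setT, (fun=> 0); split => //; last exact: Ck_on_cst.
have Ky : ~ (chart_inv c @` K) (chart_inv d y).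
  by move=> [z Kz zy]; apply: cy; rewrite -zy; exact/chart_inv_dom/Kc.
have near0 : \forall z \near y, chart_ext c f (chart_inv d z) = 0.
  exact: chart_inv_cvg dy _ (chart_ext_eq0 f0 cK Kc Ky).
by apply: filterS near0 => z /= ->.
Qed.

Lemma transition_differentiable c d x : atlas S c -> atlas S d ->
  chart_dom c x -> chart_dom d x ->
  differentiable (chart_map d \o chart_inv c) (chart_map c x).
Proof.
move=> Sc Sd cx dx; have [df _] := atlas_compatible Sc Sd 1.
by apply: df; exists x.
Qed.

Lemma near_transition c d x : chart_dom c x -> chart_dom d x ->
  \forall y \near chart_map c x,
    chart_inv d (chart_map d (chart_inv c y)) = chart_inv c y.
Proof.
move=> cx dx; have cy := chart_map_codom cx.
have near_d : \forall z \near chart_map c x, chart_dom d (chart_inv c z).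
  by apply: chart_inv_cvg => //; rewrite chart_mapKV //; exact: near_chart_dom.
by apply: filterS near_d => z; exact: chart_mapKV.
Qed.

(** Invariance of the differential under a change of charts.  The target [W] is
  arbitrary so that [F] may itself be a chart. *)
Lemma diff_chart_change (W : normedModType R) c d x (F : M -> W) u :
  atlas S c -> atlas S d -> chart_dom c x -> chart_dom d x ->
  differentiable (F \o chart_inv c) (chart_map c x) ->
  'd (F \o chart_inv d) (chart_map d x)
    ('d (chart_map d \o chart_inv c) (chart_map c x) u) =
  'd (F \o chart_inv c) (chart_map c x) u.
Proof.
move=> Sc Sd cx dx dF.
have dcd := transition_differentiable Sc Sd cx dx.
have ddc := transition_differentiable Sd Sc dx cx.
have zcx : chart_map d (chart_inv c (chart_map c x)) = chart_map d x.
  by rewrite chart_mapKV.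
have zdx : chart_map c (chart_inv d (chart_map d x)) = chart_map c x.
  by rewrite chart_mapKV.
apply/esym; apply: (diff_factor (f := F \o chart_inv d) zcx dcd).
  apply: (differentiable_factor (f := F \o chart_inv c) zdx ddc dF).
  by apply: filterS (near_transition dx cx) => y /= ->.
by apply: filterS (near_transition cx dx) => y /= ->.
Qed.

End Charts.

(** * The Poisson bracket in a chart *)

Section Symplectic.
Context {R : realType} {m : nat} {M : topologicalType}.
Variables (S : smooth_manifold R m M) (w : symplectic_form S).
Implicit Types (F G : M -> R) (c d : chart R m M) (x : M) (y : 'rV[R]_m).

Lemma chart_at_atlas x : atlas S (chart_at S x).
Proof. by rewrite /chart_at; case: cid => c []. Qed.

Lemma chart_at_dom x : chart_dom (chart_at S x) x.
Proof. by rewrite /chart_at; case: cid => c []. Qed.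

Lemma hamiltonian_vector_fieldE G x (u : tangent_space S x) :
  is_hamiltonian_vector w G u -> hamiltonian_vector_field w G x = u.
Proof.
move=> Gu; set u' := hamiltonian_vector_field w G x.
have Gu' : is_hamiltonian_vector w G u'.
  by apply: (@xgetPex _ _ (is_hamiltonian_vector w G (x := x))); exists u.
apply/eqP; rewrite -subr_eq0 -scaleN1r addrC; apply/eqP.
apply: (@symplectic_nondegenerate _ _ _ _ w) => v.
by rewrite symplectic_linear Gu Gu' mulN1r addNr.
Qed.

Lemma differential_locally_cst F x a (u : tangent_space S x) :
  (\forall z \near x, F z = a) -> differential F u = 0.
Proof.
move=> Fa; rewrite /differential; set c := chart_at S x.
have cx : chart_dom c x := chart_at_dom x.
have Fa' : \forall z \near chart_map c x, cst a z = (F \o chart_inv c) z.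
  have H : \forall z \near chart_map c x, F (chart_inv c z) = a.
    have Fa' : \forall z \near chart_inv c (chart_map c x), F z = a.
      by rewrite chart_mapKV.
    exact: chart_inv_cvg (chart_map_codom cx) _ Fa'.
  by apply: filterS H => z /= ->.
have [_ ->] := near_eq_is_diff Fa' (differentiable_cst a _).
by rewrite diff_cst.
Qed.

Lemma bracket_locally_cstl F G x a :
  (\forall z \near x, F z = a) -> poisson_bracket w F G x = 0.
Proof. exact: differential_locally_cst. Qed.

Lemma bracket_locally_cstr F G x a :
  (\forall z \near x, G z = a) -> poisson_bracket w F G x = 0.
Proof.
move=> Ga; rewrite /poisson_bracket (@hamiltonian_vector_fieldE G x 0).
  by rewrite /differential linear0.
move=> v; rewrite (differential_locally_cst _ Ga) oppr0.
have := symplectic_linear w 1 0 0 v; rewrite scale1r addr0 mul1r => E.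
by apply: (addrI (symplectic_of w 0 v)); rewrite addr0; exact: esym E.
Qed.

(** Apply [diff_chart_change] to [F = chart_map c], which reads as the identity
  in the chart [c]. *)
Lemma transitionK c d x u :
  atlas S c -> atlas S d -> chart_dom c x -> chart_dom d x ->
  'd (chart_map c \o chart_inv d) (chart_map d x)
    ('d (chart_map d \o chart_inv c) (chart_map c x) u) = u.
Proof.
move=> Sc Sd cx dx.
have nid : \forall z \near chart_map c x, id z = (chart_map c \o chart_inv c) z.
  apply: filterS (near_chart_codom (chart_map_codom cx)) => z cz /=.
  by rewrite chart_invK.
have dc := near_eq_is_diff nid (_ : differentiable id (chart_map c x)).
rewrite (@diff_chart_change _ _ _ S _ c d x (chart_map c)) //.
  by have [_ ->] := dc ex_diff; rewrite diff_val.
by have [] := dc ex_diff.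
Qed.

Section InChart.
Variables (c : chart R m M) (Sc : atlas S c) (y : 'rV[R]_m).
Hypothesis (cy : chart_codom c y).

Let x := chart_inv c y.
Let d := chart_at S x.
Let cx : chart_dom c x := chart_inv_dom cy.
Let dx : chart_dom d x := chart_at_dom x.
Let Sd : atlas S d := chart_at_atlas x.

Lemma tangent_of_coord_surj (v : tangent_space S x) :
  exists u, tangent_of_coord S c y u = v.
Proof.
exists ('d (chart_map c \o chart_inv d) (chart_map d x) v).
by have := transitionK v Sd Sc dx cx; rewrite chart_invK.
Qed.

Lemma tangent_of_coord_inj u : tangent_of_coord S c y u = 0 -> u = 0.
Proof.
move=> u0; have := transitionK u Sc Sd cx dx; rewrite (chart_invK cy).
set T := 'd (chart_map c \o _) _ => TE.
exact: etrans (esym TE) (etrans (congr1 T u0) (linear0 T)).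
Qed.

Lemma differential_coord F u : differentiable (F \o chart_inv c) y ->
  differential F (tangent_of_coord S c y u) = 'd (F \o chart_inv c) y u.
Proof.
move=> dF; have := @diff_chart_change _ _ _ S _ c d x F u Sc Sd cx dx.
by rewrite chart_invK //; apply.
Qed.

(** The Gram matrix of the symplectic form on the coordinate vectors of the
  fixed chart [c], as opposed to the preferred chart of each point. *)
Definition symplectic_mx (z : 'rV[R]_m) : 'M[R]_m :=
  \matrix_(p, q) form2_coef (symplectic_of w) c (delta_mx 0 p) (delta_mx 0 q) z.

Lemma symplectic_mxE u v : form2_coef (symplectic_of w) c u v y =
  (u *m symplectic_mx y *m v^T) 0 0.
Proof.
pose B a b := form2_coef (symplectic_of w) c a b y.
have Bl b : linear (B ^~ b).
  move=> k a a'; rewrite /B /form2_coef /tangent_of_coord.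
  by rewrite linearP symplectic_linear.
have BN a b : B a b = - B b a by exact: symplectic_alternating.
have Bsum a b : B a b = \sum_p a 0 p * B (delta_mx 0 p) b.
  pose P : {linear 'rV[R]_m -> R} :=
    HB.pack (B ^~ b) (GRing.isLinear.Build _ _ _ _ _ (Bl b)).
  rewrite -[LHS]/(P a) [in LHS](row_sum_delta a) linear_sum.
  by apply: eq_bigr => p _; rewrite linearZ.
rewrite -/(B u v) Bsum -mulmxA mxE; apply: eq_bigr => p _; congr (_ * _).
rewrite BN Bsum mxE -sumrN; apply: eq_bigr => q _.
by rewrite !mxE -mulrN -BN mulrC.
Qed.

(** A row vector in the kernel is orthogonal to all tangent vectors, since they
  all come from coordinate vectors. *)
Lemma symplectic_mx_unit : symplectic_mx y \in unitmx.
Proof.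
rewrite -row_free_unit -kermx_eq0; apply/rowV0P => u /sub_kermxP uO.
apply: tangent_of_coord_inj; apply: (@symplectic_nondegenerate _ _ _ _ w) => v.
have [v' <-] := tangent_of_coord_surj v.
by rewrite -/(form2_coef _ _ _ _ _) symplectic_mxE uO mul0mx mxE.
Qed.

Lemma symplectic_mx_skew : (symplectic_mx y)^T = - symplectic_mx y.
Proof.
by apply/matrixP => p q; rewrite !mxE; exact: symplectic_alternating.
Qed.

(** In coordinates the equation [w (X, .) = - dG] is the linear system
  [X *m symplectic_mx = - gradient G]. *)
Lemma bracket_coord F G :
  differentiable (F \o chart_inv c) y -> differentiable (G \o chart_inv c) y ->
  poisson_bracket w F G x = 'd (F \o chart_inv c) y
    (- gradient (G \o chart_inv c) y *m invmx (symplectic_mx y)).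
Proof.
move=> dF dG; rewrite /poisson_bracket.
set u := - _ *m _.
rewrite (@hamiltonian_vector_fieldE G x (tangent_of_coord S c y u)).
  exact: differential_coord.
move=> v; have [v' <-] := tangent_of_coord_surj v.
rewrite differential_coord // gradientE.
rewrite -/(form2_coef _ _ _ _ _) symplectic_mxE.
by rewrite /u mulmxKV ?symplectic_mx_unit // mulNmx mxE.
Qed.

End InChart.
End Symplectic.

Lemma uniform_norm_le (R : realType) (M : Type) (F : M -> R) (b : R) :
  [set: M] !=set0 ->
  (forall x, `|F x| <= b) -> uniform_norm F <= b.
Proof.
move=> [x _] Fb; apply: ge_sup; first by exists `|F x|, x.
by move=> _ [z _ <-].
Qed.

Section DoubleBracket.
Context {R : realType} {m : nat} {M : topologicalType}.
Variables (S : smooth_manifold R m M) (w : symplectic_form S).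

(** Since [G] has the form [l^2] with [l = z_i - y_i], [{G, F} = 2 l {l, F}].
  This vanishes at [y] with gradient [2 {l, F}] times that of [l], for which the
  continuity of [{l, F}] suffices.  A second bracket with [F] produces the
  square of [{l, F}] up to sign, because the inverse matrix is skew. *)
Lemma double_bracket c y i j (a b : R) (F G : M -> R) : atlas S c ->
  chart_codom c y ->
  {near y, (fun z : 'rV[R]_m => a * z 0 j + b) =1 F \o chart_inv c} ->
  {near y, (fun z : 'rV[R]_m => (z 0 i - y 0 i) ^+ 2) =1 G \o chart_inv c} ->
  poisson_bracket w F (poisson_bracket w G F) (chart_inv c y) =
  - 2 * (a * invmx (symplectic_mx w c y) i j) ^+ 2.
Proof.
move=> Sc cy FE GE; set O := symplectic_mx w c.
pose k z := - 2 * a * invmx (O z) j i.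
have ck : {for y, continuous k}.
  apply: (@cvgM _ _ (nbhs y) _ (fun=> - 2 * a) (fun z => invmx (O z) j i)).
    exact: cvg_cst.
  apply: cvg_invmx.
  - by apply: filterS (near_chart_codom cy) => z cz; exact: symplectic_mx_unit.
  - exact: symplectic_mx_unit.
  move=> p q; pose coef := form2_coef (symplectic_of w) c (delta_mx 0 p)
    (delta_mx 0 q).
  have OE z : O z p q = coef z by rewrite /O mxE.
  have -> : (fun z => O z p q) = coef by apply/funext.
  have c0 : {for y, continuous coef} := symplectic_smooth w _ _ Sc 0%N y cy.
  by rewrite OE.
have KE : {near y, (fun z : 'rV[R]_m => (z 0 i - y 0 i) * k z) =1
    poisson_bracket w G F \o chart_inv c}.
  apply: filterS3 (near_chart_codom cy) (near_join FE) (near_join GE).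
  move=> z cz Fz Gz.
  have [dF gF] := gradient_affine Fz; have [dG gG] := gradient_square Gz.
  rewrite /= bracket_coord // gradientE gF gG -/O -scaleNr -!scalemxAl -!rowE.
  by rewrite !mxE /k; ring.
have [dF gF] := gradient_affine FE; have [dK gK] := gradient_coord_mul ck KE.
rewrite bracket_coord // gradientE gF gK -/O -scaleNr -!scalemxAl -!rowE !mxE.
have -> : invmx (O y) i j = - invmx (O y) j i.
  rewrite -[in LHS](trmxK (invmx (O y))) mxE trmx_inv symplectic_mx_skew //.
  rewrite -scaleN1r invmxZ ?unitrN1 ?unitmxZ ?unitrN1 ?symplectic_mx_unit //.
  by rewrite invrN1 scaleN1r mxE.
by rewrite /k; ring.
Qed.

End DoubleBracket.

(** * The functions and their perturbations *)

Section Approximation.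
Context {R : realType} {m : nat} {M : topologicalType}.
Variables (S : smooth_manifold R m M) (w : symplectic_form S).
Variables (c : chart R m M) (Sc : atlas S c).
Variables (y0 : 'rV[R]_m) (r : R) (i j : 'I_m).
Hypotheses (r0 : 0 < r)
  (box_codom : [set y | `|y - y0| <= 4 * r] `<=` chart_codom c).

Implicit Types (f : R -> R) (y : 'rV[R]_m).

(** The shift by [4] makes this function range over [[0, 8]] on the box of
  radius [4 * r], the support of the wide plateau. *)
Definition slope_coord (y : 'rV[R]_m) : R := r^-1 * (y 0 j - y0 0 j) + 4.

Definition cut_slope (f : R -> R) : M -> R :=
  chart_ext c (fun y => plateau y0 r y * f (slope_coord y)).

(** The narrow plateau is supported in the box of radius [2 * r], while the wide
  one equals [1] on the box of radius [3 * r]: in between, a neighbourhood of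
  the support of [cut_square] sees [cut_slope f] as [f] of the slope. *)
Definition cut_square : M -> R :=
  chart_ext c (fun y => plateau y0 (r / 2) y * (y 0 i - y0 0 i) ^+ 2).

Let r2 : 0 < r / 2. Proof. by rewrite divr_gt0. Qed.

Let in_codom q y : q <= 4 -> `|y - y0| <= q * r -> chart_codom c y.
Proof.
by move=> q4 yr; apply: box_codom; rewrite /= (le_trans yr) // ler_pM2r.
Qed.

Lemma smooth_cut_slope f : (forall k, Ck_on k setT f) ->
  smooth_compactly_supported S (cut_slope f).
Proof.
move=> kf; apply: (smooth_chart_ext Sc (K := [set y | `|y - y0| <= 4 * r])).
- move=> k; apply: Ck_on_subset (@subsetT _ _) _.
  apply: (Ck_onM openT (Ck_on_plateau _ _ _)).
  exact: (Ck_on_comp1 openT (U' := setT) _ (kf k)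
    (Ck_on_scaled_coord _ _ _ _ _)).
- move=> y _ /negP; rewrite -ltNge => /ltW yr.
  by rewrite plateau_eq0 ?mul0r.
- exact: compact_box.
- exact: box_codom.
Qed.

Lemma smooth_cut_square : smooth_compactly_supported S cut_square.
Proof.
apply: (smooth_chart_ext Sc (K := [set y | `|y - y0| <= 2 * r])).
- move=> k; apply: Ck_on_subset (@subsetT _ _) _.
  apply: (Ck_onM openT (Ck_on_plateau _ _ _)).
  have kc : Ck_on k setT (fun y : 'rV[R]_m => y 0 i - y0 0 i).
    apply: (Ck_onD openT _ (Ck_on_cst _ _ _)).
    exact: (Ck_on_coord _ openT (Ck_on_id _ _)).
  exact: (Ck_onM openT kc kc).
- move=> y _ /negP; rewrite -ltNge => yr.
  by rewrite plateau_eq0 ?mul0r //; lra.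
- exact: compact_box.
- by move=> y; apply: in_codom; lra.
Qed.

Lemma cut_slopeE f y : `|y - y0| <= 3 * r ->
  cut_slope f (chart_inv c y) = f (slope_coord y).
Proof.
move=> yr; rewrite /cut_slope chart_ext_inv ?plateau_eq1 ?mul1r //.
by apply: in_codom yr; lra.
Qed.

Lemma cut_squareE y : `|y - y0| <= 1 * r ->
  cut_square (chart_inv c y) = (y 0 i - y0 0 i) ^+ 2.
Proof.
move=> yr; rewrite /cut_square chart_ext_inv; last by apply: in_codom yr; lra.
by rewrite plateau_eq1 ?mul1r // (le_trans yr) //; have := r0; lra.
Qed.

Lemma cut_slope_dist f e : 0 <= e ->
  (forall t, 0 <= t <= 8 -> `|f t - t| <= e) ->
  forall x, `|cut_slope f x - cut_slope id x| <= e.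
Proof.
move=> e0 fe x; rewrite /cut_slope /chart_ext.
case: ifPn => [/set_mem cx|_]; last by rewrite subrr normr0.
set y := chart_map c x; rewrite -mulrBr.
have [yr|yr] := leP (`|y - y0|) (4 * r); last first.
  by rewrite plateau_eq0 ?mul0r ?normr0 //; exact: ltW.
rewrite normrM ger0_norm ?plateau_ge0 // -[leRHS]mul1r.
rewrite ler_pM ?plateau_ge0 ?plateau_le1 //; apply: fe.
have : `|r^-1 * (y 0 j - y0 0 j)| <= 4.
  rewrite normrM gtr0_norm ?invr_gt0 // ler_pdivrMl // mulrC.
  by have := coord_le_norm (y - y0) j; rewrite !mxE => /le_trans; exact.
by rewrite ler_norml /slope_coord => /andP[t1 t2]; lra.
Qed.

Lemma cut_slope_locally_cst f y : `|y - y0| < 3 * r ->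
  (\forall t \near slope_coord y, f t = f (slope_coord y)) ->
  \forall x \near chart_inv c y, cut_slope f x = f (slope_coord y).
Proof.
move=> yr fcst.
have cy : chart_codom c y by apply: in_codom (ltW yr); lra.
have near_f : \forall z \near y, f (slope_coord z) = f (slope_coord y).
  have [df _] := Ck_on_scaled_coord y0 r 4 j 1.
  exact: (differentiable_continuous (df y I)) _ fcst.
have near_r : \forall z \near y, `|z - y0| < 3 * r.
  have yb : ball y0 (3 * r) y by rewrite -ball_normE /= distrC.
  apply: filterS (open_nbhs_nbhs (conj (ball_open _ _) yb)) => z.
  by rewrite -ball_normE /= distrC.
have cx := chart_inv_dom cy.
have near_x : \forall x \near chart_inv c y,
    `|chart_map c x - y0| < 3 * r /\
    f (slope_coord (chart_map c x)) = f (slope_coord y).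
  have near_rf : \forall z \near chart_map c (chart_inv c y),
      `|z - y0| < 3 * r /\ f (slope_coord z) = f (slope_coord y).
    by rewrite chart_invK //; apply: filterS2 near_r near_f => z; split.
  exact: chart_map_cvg cx _ near_rf.
apply: filterS2 near_x (near_chart_dom cx) => x [xr xf] dx.
by rewrite -[x in LHS](chart_mapKV dx) cut_slopeE // ltW.
Qed.

(** On the support of [cut_square] one of the two outer functions is locally
  constant, and a bracket with a locally constant function is zero.  Off that
  support [cut_square] is itself locally zero. *)
Lemma double_bracket_alternating_cut (s t : R -> R) :
  (forall v, (\forall v' \near v, s v' = s v) \/
             (\forall v' \near v, t v' = t v)) ->
  forall x,
    poisson_bracket w (cut_slope s)
      (poisson_bracket w cut_square (cut_slope t)) x = 0.
Proof.
move=> st x.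
have [[y yr <-]|xK] :=
    pselect ((chart_inv c @` [set y | `|y - y0| <= 2 * r]) x).
  have yr3 : `|y - y0| < 3 * r.
    by rewrite (le_lt_trans yr) // ltr_pM2r // ltr_nat.
  have [sy|ty] := st (slope_coord y).
    exact: bracket_locally_cstl (cut_slope_locally_cst yr3 sy).
  apply: (@bracket_locally_cstr _ _ _ _ _ _ _ _ 0).
  apply: filterS (near_join (cut_slope_locally_cst yr3 ty)) => z.
  exact: bracket_locally_cstr.
apply: (@bracket_locally_cstr _ _ _ _ _ _ _ _ 0).
have near0 : \forall z \near x, cut_square z = 0.
  apply: (chart_ext_eq0 S _ _ _ xK).
  - move=> y _ /negP; rewrite -ltNge => yr.
    by rewrite plateau_eq0 ?mul0r //; lra.
  - exact: compact_box.
  - by move=> y; apply: in_codom; lra.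
apply: filterS (near_join near0) => z; exact: bracket_locally_cstl.
Qed.

Lemma double_bracket_cut :
  poisson_bracket w (cut_slope id)
    (poisson_bracket w cut_square (cut_slope id)) (chart_inv c y0) =
  - 2 * (r^-1 * invmx (symplectic_mx w c y0) i j) ^+ 2.
Proof.
have near_r : \forall y \near y0, `|y - y0| <= 1 * r.
  rewrite mul1r; apply: filterS (nbhsx_ballx y0 r r0) => y.
  by rewrite -ball_normE /= distrC => /ltW.
apply: (@double_bracket _ _ _ _ _ _ _ _ _ _ (4 - r^-1 * y0 0 j)) => //.
- by apply: box_codom; rewrite /= subrr normr0 mulr_ge0 // ltW.
- apply: filterS near_r => y yr; rewrite /= cut_slopeE; last first.
    by rewrite (le_trans yr) // ler_pM2r // ler1n.
  by rewrite /slope_coord /=; ring.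
- by apply: filterS near_r => y yr; rewrite /= cut_squareE.
Qed.

End Approximation.

(** * Double brackets are not rigid *)

Theorem theorem1p6 (R : realType) (m : nat) (M : topologicalType)
    (S : smooth_manifold R m M) (w : symplectic_form S)
    (m_gt0 : (0 < m)%N) (M_nonempty : [set: M] !=set0) :
  exists F G H : M -> R,
    [/\ smooth_compactly_supported S F,
        smooth_compactly_supported S G,
        smooth_compactly_supported S H,
        exists x, poisson_bracket w F (poisson_bracket w G H) x != 0
      & forall e : R, 0 < e ->
        exists F' G' H' : M -> R,
          [/\ smooth_compactly_supported S F',
              smooth_compactly_supported S G',
              smooth_compactly_supported S H',
              [/\ uniform_norm (F' \- F) < e,
                  uniform_norm (G' \- G) < e
                & uniform_norm (H' \- H) < e]
            & forall x, poisson_bracket w F' (poisson_bracket w G' H') x = 0]].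
Proof.
have [x0 _] := M_nonempty; pose c := chart_at S x0.
have Sc : atlas S c := chart_at_atlas S x0.
pose y0 := chart_map c x0.
have cy0 : chart_codom c y0 := chart_map_codom (chart_at_dom S x0).
have [i [j Oij]] : exists i j, invmx (symplectic_mx w c y0) i j != 0.
  apply: contrapT => O0.
  have inv0 : invmx (symplectic_mx w c y0) = 0.
    apply/matrixP => i j; rewrite mxE; apply: contrapT => /eqP Oij.
    by apply: O0; exists i, j.
  have := mulmxV (symplectic_mx_unit w Sc cy0); rewrite inv0 mulmx0.
  move=> /matrixP /(_ (Ordinal m_gt0) (Ordinal m_gt0)) /eqP.
  by rewrite !mxE eqxx eq_sym oner_eq0.
have [r r0 box_codom] : exists2 r, 0 < r &
    [set y | `|y - y0| <= 4 * r] `<=` chart_codom c.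
  have /nbhs_ballP[e /= e0 eC] := near_chart_codom cy0.
  exists (e / 5) => [|y /= yr]; first by rewrite divr_gt0.
  by apply: eC; rewrite -ball_normE /= distrC; lra.
pose F := cut_slope c y0 r j id; pose G := cut_square c y0 r i.
have sF f : (forall k, Ck_on k setT f) ->
    smooth_compactly_supported S (cut_slope c y0 r j f).
  exact: smooth_cut_slope.
have sG : smooth_compactly_supported S G by exact: smooth_cut_square.
have sid : smooth_compactly_supported S F.
  by apply: sF => k; exact: Ck_on_id.
exists F, G, F; split => //.
  exists (chart_inv c y0); rewrite double_bracket_cut // mulf_neq0 //.
  by rewrite sqrf_eq0 mulf_neq0 // invr_neq0 // gt_eqF.
move=> e e0; have e2 : 0 < e / 2 by rewrite divr_gt0.
have [s [t [ks kt se te st]]] := alternating_staircases (ler0n R 8) e2.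
exists (cut_slope c y0 r j s), G, (cut_slope c y0 r j t); split.
- exact: sF.
- exact: sG.
- exact: sF.
- have norm_lt (f : M -> R) : (forall x, `|f x| <= e / 2) -> uniform_norm f < e.
    move=> fe; have := uniform_norm_le M_nonempty fe; lra.
  split; apply: norm_lt => x /=.
  + exact: cut_slope_dist (ltW e2) se x.
  + by rewrite subrr normr0 ltW.
  + exact: cut_slope_dist (ltW e2) te x.
- exact: double_bracket_alternating_cut.
Qed.
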